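(* Let $0<\alpha<\beta<1$ with $\beta>1/2$. Then for every real number $M$ there exists an irreducible Markov chain on a finite state space with $T(\beta)=0$ and $T(\alpha)\ge M$.
   Context: For an irreducible discrete-time Markov chain $X=(X_t)_{t\ge 0}$ with finite state space $\Omega$ and stationary distribution $\pi$, the hitting time of $A\subseteq\Omega$ is $\tau_A=\min\{t\ge 0: X_t\in A\}$, and $\mathbb{E}_x$ denotes expectation for the chain started at $X_0=x$. For $\gamma\in(0,1)$, $$T(\gamma)=\max\{\mathbb{E}_x[\tau_A] : x\in\Omega,\ A\subseteq\Omega,\ \pi(A)\ge\gamma\}.$$ *)

(* Defs.v *)
From HB Require Import structures.
From mathcomp Require Import all_boot all_order all_algebra.
From mathcomp Require Import all_classical all_reals all_analysis.

Set Implicit Arguments.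
Unset Strict Implicit.
Unset Printing Implicit Defensive.

Import Order.TTheory GRing.Theory Num.Theory.

Local Open Scope classical_set_scope.
Local Open Scope ring_scope.

(* A time-homogeneous Markov chain on a finite state space, presented as a
   process [mc_proc] on one sample space carrying a family of probabilities:
   [mc_law x] is the law P_x of the chain started at x. *)
Record markov_chain (R : realType) := MarkovChain {
  mc_state : finType;
  mc_trans : mc_state -> mc_state -> R;
  mc_trans_ge0 : forall x y, 0 <= mc_trans x y;
  mc_trans_sum1 : forall x, \sum_(y : mc_state) mc_trans x y = 1;
  mc_disp : measure_display;
  mc_sample : measurableType mc_disp;
  mc_law : mc_state -> probability mc_sample R;
  mc_proc : nat -> mc_sample -> mc_state;
  mc_proc_measurable : forall t y, measurable (mc_proc t @^-1` [set y]);
  mc_proc_start : forall x, mc_law x [set w | mc_proc 0%N w = x] = 1%E;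
  (* P_x(X_0 = h 0, ..., X_t = h t, X_(t+1) = y)
       = P_x(X_0 = h 0, ..., X_t = h t) * P(h t, y);
     in this product form no conditioning on a null event occurs. *)
  mc_proc_markov : forall x t (h : nat -> mc_state) y,
    mc_law x [set w | (forall s, (s <= t)%N -> mc_proc s w = h s) /\
                      mc_proc t.+1 w = y]
    = (mc_law x [set w | forall s, (s <= t)%N -> mc_proc s w = h s]
       * (mc_trans (h t) y)%:E)%E
}.

Section MarkovChain.
Variables (R : realType) (C : markov_chain R).
Implicit Types (x y : mc_state C) (A : {set mc_state C}).

Fixpoint nstep_trans (t : nat) x y : R :=
  if t is t'.+1 then \sum_(z : mc_state C) mc_trans x z * nstep_trans t' z y
  else (x == y)%:R.

Definition irreducible_chain : Prop :=
  forall x y, exists t : nat, 0 < nstep_trans t x y.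

Definition stationary_distribution (p : mc_state C -> R) : Prop :=
  [/\ forall x, 0 <= p x,
      \sum_(x : mc_state C) p x = 1
    & forall y, \sum_(x : mc_state C) p x * mc_trans x y = p y].

(* The infimum of the empty set is +oo, so the hitting time is +oo on the
   trajectories that never visit A; otherwise it is a minimum. *)
Definition hitting_time A (w : mc_sample C) : \bar R :=
  ereal_inf [set (t%:R)%:E | t in [set t : nat | mc_proc t w \in A]].

Definition expected_hitting_time x A : \bar R :=
  (\int[mc_law x]_w hitting_time A w)%E.

(* [p] is meant to be the stationary distribution of [C]. The default value -oo
   of the maximum plays no role for g <= 1, since A may be the whole space. *)
Definition max_hitting_time (p : mc_state C -> R) (g : R) : \bar R :=
  \big[maxe/-oo%E]_(x : mc_state C)
    \big[maxe/-oo%E]_(A : {set mc_state C} | g <= \sum_(a in A) p a)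
      expected_hitting_time x A.

End MarkovChain.

(* Main.v *)
Require Import Defs.
From HB Require Import structures.
From mathcomp Require Import all_boot all_order all_algebra.
From mathcomp Require Import all_classical all_reals all_analysis.
From mathcomp Require Import measurable_realfun ring lra.
Import Order.TTheory GRing.Theory Num.Theory.
Local Open Scope ring_scope.

(** If every state has mass larger than [1 - beta], then a set of mass at least
    [beta] misses no state: it is the whole space, and its hitting time is 0
    ([max_hitting_time_eq0]). Two states are enough. Put
    [a = max(alpha, 1/2)] and give the states [true] and [false] the masses [a]
    and [1 - a]; both exceed [1 - beta] because [1/2 <= a < beta],
    and the singleton of [true] competes in the maximum for [alpha]. Stationarity fixes
    only the ratio of the two switching probabilities, so the one from [false]
    to [true] can be any small [q]. The chain then stays at [false] for [N]
    steps with probability [(1 - q) ^ N], which bounds the expected hitting time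
    of [true] below ([expected_hitting_time_ge]); with [q = 1 / (2 N)] this is at
    least [N / 2], and [N] is arbitrary.

    It remains to realize a two-state chain on one sample space. The sample
    space is the real line, and the law of the chain started at a given state is
    the Lebesgue measure on a unit interval attached to this state. Each interval
    of trajectories sharing the same past is cut in two in proportion to the
    transition probabilities, and the next state records the side of the cut.
    The trajectories with a prescribed past then form an interval whose length
    is the product of the transition probabilities ([start_law_path]), which is
    the Markov property ([walk_markov]). *)

(** * Hitting times of a finite chain *)

Section HittingTimes.
Local Open Scope classical_set_scope.
Variables (R : realType) (C : markov_chain R).
Implicit Types (x : mc_state C) (A : {set mc_state C}) (w : mc_sample C).

Lemma hitting_time_ge0 A w : (0 <= hitting_time A w)%E.
Proof. by apply: le_ereal_inf_tmp => _ [t _ <-]; rewrite lee_fin. Qed.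

(** The hitting time is the infimum over [t] of the measurable functions equal to
    [t] where the chain is in [A] at time [t], and to +oo elsewhere. *)
Lemma measurable_hitting_time A : measurable_fun setT (hitting_time A : mc_sample C -> \bar R).
Proof.
pose f t w : \bar R := if mc_proc t w \in A then (t%:R)%:E else +oo%E.
rewrite (_ : hitting_time A = fun w => einfs (f ^~ w) 0%N); last first.
  apply/funext => w; apply/eqP; rewrite eq_le; apply/andP; split.
    apply: le_ereal_inf_tmp => _ [t _ <-]; rewrite /f.
    by case: ifPn => [tA|_]; [apply: ereal_inf_lbound; exists t | exact: leey].
  apply: le_ereal_inf_tmp => _ [t tA <-]; apply: ereal_inf_lbound.
  by exists t => //; rewrite /f tA.
apply: measurable_fun_einfs => t; apply: measurable_fun_ifT => //.
apply: (measurable_fun_bool true); rewrite setTI.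
rewrite (_ : _ @^-1` _ = \bigcup_(y in [set` A]) (mc_proc t @^-1` [set y])).
  by apply: fin_bigcup_measurable => // y _; exact: mc_proc_measurable.
by apply/seteqP; split => [w wA|w [y yA /= ->]//]; exists (mc_proc t w).
Qed.

Lemma expected_hitting_time_setT x : expected_hitting_time x [set: mc_state C]%SET = 0%E.
Proof.
apply: integral0_eq => w _; apply/eqP; rewrite eq_le hitting_time_ge0 andbT.
by apply: ereal_inf_lbound; exists 0%N; rewrite //= inE.
Qed.

Definition holding x t : set (mc_sample C) :=
  [set w | forall s, (s <= t)%N -> mc_proc s w = x].

Lemma measurable_holding x t : measurable (holding x t).
Proof.
rewrite (_ : holding x t = \bigcap_(s in `I_t.+1) (mc_proc s @^-1` [set x])).
  by apply: bigcap_measurable => [|s _]; [exists 0%N|exact: mc_proc_measurable].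
by apply/seteqP; split => w hw s; [move=> st; apply: hw|move=> st; apply: hw].
Qed.

(** The Markov property along the constant trajectory. *)
Lemma mc_law_holding x t : mc_law x (holding x t) = (mc_trans x x ^+ t)%:E.
Proof.
elim: t => [|t IH].
  rewrite expr0 -(mc_proc_start x); congr (mc_law x _).
  by apply/seteqP; split => w /= h; [exact: h|case].
rewrite exprSr EFinM -IH -(mc_proc_markov x t (fun=> x)); congr (mc_law x _).
apply/seteqP; split => w /= => [h|[h hx] s].
  by split => [s st|]; apply: h => //; exact: leqW.
by rewrite leq_eqVlt => /predU1P[->//|]; exact: h.
Qed.

(** On the event that the chain has not moved up to time [t], no point outside
    its initial position is hit before time [t + 1]. *)
Lemma expected_hitting_time_ge x A t : x \notin A ->
  (((t.+1)%:R * mc_trans x x ^+ t)%:E <= expected_hitting_time x A)%E.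
Proof.
move=> xA; rewrite EFinM -mc_law_holding.
have mH := measurable_holding x t.
rewrite -integral_cst//.
apply: (@le_trans _ _ (\int[mc_law x]_(w in holding x t) hitting_time A w)%E).
  apply: ge0_le_integral => //.
  - by move=> w _; rewrite lee_fin.
  - exact: measurable_funTS (measurable_hitting_time A).
  - move=> w hw; apply: le_ereal_inf_tmp => _ [s sA <-].
    rewrite lee_fin ler_nat ltnNge; apply/negP => st.
    by move: sA => /=; rewrite hw// (negbTE xA).
apply: ge0_subset_integral => //.
- exact: measurable_hitting_time.
- by move=> w _; exact: hitting_time_ge0.
Qed.

Lemma le_max_hitting_time (p : mc_state C -> R) (g : R) x A :
  g <= \sum_(a in A) p a ->
  (expected_hitting_time x A <= max_hitting_time p g)%E.
Proof.
move=> gA; rewrite /max_hitting_time.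
apply: (le_trans _ (le_bigmax _ _ x)).
exact: (le_bigmax_cond _ _ gA).
Qed.

(** A set missing a state [z] has mass at most [1 - p z < g]; hence the maximum
    ranges over the whole space only. The point [x] witnesses that the outer
    maximum is not over an empty type, where it would be -oo. *)
Lemma max_hitting_time_eq0 (p : mc_state C -> R) (g : R) x :
  stationary_distribution p -> g <= 1 -> (forall x, 1 - p x < g) ->
  max_hitting_time p g = 0%E.
Proof.
move=> [p0 p1 _] g1 pg; apply/eqP; rewrite eq_le; apply/andP; split.
  apply/bigmax_leP; split=> // y _; apply/bigmax_leP; split=> // A gA.
  have [->|] := eqVneq A [set: mc_state C]%SET.
    by rewrite expected_hitting_time_setT.
  rewrite -finset.subTset => /subsetPn[z _ zA].
  have := pg z; rewrite -p1 (bigD1 z)//= addrAC subrr add0r ltNge => /negP[].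
  apply: (le_trans gA); rewrite [leRHS]big_mkcond [leLHS]big_mkcond/=.
  apply: ler_sum => a _; case: (boolP (a \in A)) => [aA|_]; last by case: ifP.
  by rewrite (contraTneq _ aA)// => ->.
rewrite -(expected_hitting_time_setT x); apply: le_max_hitting_time.
by under eq_bigl do rewrite inE; rewrite p1.
Qed.

End HittingTimes.

(** * Realization of a two-state chain by successive cuts of an interval *)

Section TwoStateChain.
Local Open Scope classical_set_scope.
(* [c b] is the probability of moving from [b] to [true]. *)
Variables (R : realType) (c : bool -> R).
Hypothesis c01 : forall b, 0 <= c b <= 1.

Definition kernel2 (b b' : bool) : R := if b' then c b else 1 - c b.

Lemma kernel2_ge0 b b' : 0 <= kernel2 b b'.
Proof. by have := c01 b; rewrite /kernel2; case: b'; lra. Qed.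

Lemma kernel2_sum1 b : \sum_(b' : bool) kernel2 b b' = 1.
Proof. by rewrite big_bool/= addrC subrK. Qed.

(** Left end of the unit interval carrying the trajectories started at [b]; the
    two intervals are disjoint, and 0 separates them. *)
Definition base (b : bool) : R := if b then 0 else -1.

(** Intervals are coded by left end and length. A cell of trajectories currently
    at [b] is cut in proportion to the transition probabilities from [b]; the
    left piece goes to [true]. *)
Definition subcell (b : bool) (I : R * R) (b' : bool) : R * R :=
  (if b' then I.1 else I.1 + I.2 * c b, I.2 * kernel2 b b').

Definition cell_itv (I : R * R) : set R := `[I.1, I.1 + I.2[.

(** The interval of the sample points that start in the unit interval of [h 0] and
    whose trajectory follows [h] up to time [t]. *)
Fixpoint cell (h : nat -> bool) t : R * R :=
  if t is s.+1 then subcell (h s) (cell h s) (h t) else (base (h 0%N), 1).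

(** The state at time [t] of the trajectory of [u], with the current cell. The
    sample points outside the two unit intervals have a trajectory too, but
    no law charges them. *)
Fixpoint walk t (u : R) : bool * (R * R) :=
  if t is s.+1 then
    let: (b, J) := walk s u in
    let b' := u < J.1 + J.2 * c b in (b', subcell b J b')
  else let b := 0 <= u in (b, (base b, 1)).

Definition walk_state t u := (walk t u).1.

(** The state and both coordinates of the cell go through the induction together,
    since the cut that decides the next state depends on all three. *)
Lemma measurable_walk t : [/\ measurable_fun setT (walk_state t),
  measurable_fun setT (fun u => (walk t u).2.1) &
  measurable_fun setT (fun u => (walk t u).2.2)].
Proof.
elim: t => [|t [m1 m2 m3]].
  have mb : measurable_fun setT (fun u : R => 0 <= u) by exact: measurable_fun_ler.
  by split => //=; rewrite /base; apply: measurable_fun_ifT.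
have mc : measurable_fun setT (fun u => c (walk t u).1).
  rewrite (_ : (fun u => _) = fun u => if walk_state t u then c true else c false).
    exact: measurable_fun_ifT.
  by apply/funext => u; rewrite /walk_state; case: (walk t u).1.
pose cut (u : R) : R := (walk t u).2.1 + (walk t u).2.2 * c (walk t u).1.
have mcut : measurable_fun setT cut.
  by apply: measurable_funD => //; exact: measurable_funM.
have mb : measurable_fun setT (fun u : R => u < cut u) by exact: measurable_fun_ltr.
have walkS u : walk t.+1 u = (u < cut u, subcell (walk t u).1 (walk t u).2 (u < cut u)).
  by rewrite /cut /=; case: (walk t u).
split; rewrite /walk_state; under eq_fun do rewrite walkS/=; rewrite ?/kernel2 => //.
  exact: measurable_fun_ifT.
apply: measurable_funM => //; apply: measurable_fun_ifT => //.
exact: measurable_funB.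
Qed.

Lemma cell_ge0 h t : 0 <= (cell h t).2.
Proof. by elim: t => [|t IH] //=; rewrite mulr_ge0// kernel2_ge0. Qed.

Lemma cell_subset h t u : cell_itv (cell h t.+1) u -> cell_itv (cell h t) u.
Proof.
have := cell_ge0 h t; rewrite /cell_itv/= /kernel2 !in_itv/=.
by have := c01 (h t); case: (h t.+1); nra.
Qed.

(** Cells decrease with time, so a point of the cell of [h] at time [t] lay in all
    the earlier ones, and each cut sent it to the side prescribed by [h]. *)
Lemma walk_cell h t u : cell_itv (cell h t) u -> walk t u = (h t, cell h t).
Proof.
elim: t => [|t IH] hu.
  rewrite /=; suff -> : (0 <= u) = h 0%N by [].
  move: hu; rewrite /cell_itv/= in_itv/=.
  by case: (h 0%N) => /andP[] /=; [move=> -> | move=> _; rewrite leNgt addNr => ->].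
rewrite /= (IH (cell_subset _ _ _ hu)).
suff -> : (u < (cell h t).1 + (cell h t).2 * c (h t)) = h t.+1 by [].
move: hu; rewrite /cell_itv/= in_itv/= /kernel2.
by case: (h t.+1) => /andP[] /= lu ul; [|apply/negbTE; rewrite -leNgt].
Qed.

(** Intersecting with the initial cell discards the points outside the unit
    interval attached to [h 0], on which the walk is also defined. *)
Lemma cellP h t : cell_itv (cell h t) =
  [set u | forall s, (s <= t)%N -> walk_state s u = h s] `&` cell_itv (cell h 0%N).
Proof.
apply/seteqP; split => u.
  elim: t => [|t IH] hu.
    by split => // s; rewrite leqn0 => /eqP->; rewrite /walk_state (walk_cell _ _ _ hu).
  have [hs h0] := IH (cell_subset _ _ _ hu); split => // s.
  by rewrite leq_eqVlt => /predU1P[->|/hs//]; rewrite /walk_state (walk_cell _ _ _ hu).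
elim: t => [|t IH] [hs h0] //.
have hu : cell_itv (cell h t) u by apply: IH; split => // s st; apply: hs; exact: leqW.
have := hs t.+1 (leqnn _); rewrite /walk_state/= (walk_cell _ _ _ hu)/= => <-.
move: hu; rewrite /cell_itv/= !in_itv/= /kernel2 => /andP[lu ul].
case: ltP => /= hcut; first by rewrite lu.
by rewrite hcut/=; lra.
Qed.

Let measurable_start b : measurable (cell_itv (base b, 1)).
Proof. exact: measurable_itv. Qed.

Definition start_law (b : bool) : set (measurableTypeR R) -> \bar R :=
  mrestr (@lebesgue_measure R) (measurable_start b).

HB.instance Definition _ b := Measure.copy (start_law b)
  (mrestr (@lebesgue_measure R) (measurable_start b)).

Lemma lebesgue_cell_itv (I : R * R) : 0 <= I.2 ->
  lebesgue_measure (cell_itv I) = (I.2)%:E.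
Proof.
move=> I0; rewrite /cell_itv lebesgue_measure_itv/= lte_fin ltrDl lt_neqAle I0 andbT.
by case: eqVneq => [<-//|_]; rewrite /= -EFinB addrAC subrr add0r.
Qed.

Let start_law_setT b : start_law b setT = 1%E.
Proof. by rewrite /start_law/mrestr setTI lebesgue_cell_itv. Qed.

HB.instance Definition _ b :=
  Measure_isProbability.Build _ _ _ (start_law b) (start_law_setT b).

(** The path event meets the unit interval of [b] in the cell of [h] if [h]
    starts at [b], and nowhere otherwise. *)
Lemma start_law_path b h t :
  start_law b [set u | forall s, (s <= t)%N -> walk_state s u = h s] =
  ((b == h 0%N)%:R * (cell h t).2)%:E.
Proof.
have [->|bh] := eqVneq b (h 0%N).
  rewrite mul1r -lebesgue_cell_itv ?cell_ge0// [in RHS]cellP.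
  by rewrite /start_law/mrestr/=.
rewrite mul0r /start_law/mrestr (_ : _ `&` _ = set0) ?measure0//.
apply/seteqP; split => // u [/(_ 0%N erefl) hu ub].
by move/eqP: bh; apply; rewrite -hu /walk_state (walk_cell (fun=> b) 0 u ub).
Qed.

Lemma walk_start b : start_law b [set u | walk_state 0 u = b] = 1%E.
Proof.
rewrite -[RHS](_ : ((b == b)%:R * 1 : R)%:E = _); last by rewrite eqxx mul1r.
rewrite -(start_law_path b (fun=> b) 0); congr (start_law b _).
by apply/seteqP; split => u /= h; [move=> s; rewrite leqn0 => /eqP->|exact: h].
Qed.

Lemma eq_cell h h' t : (forall s, (s <= t)%N -> h s = h' s) -> cell h t = cell h' t.
Proof.
elim: t => [|t IH] hh' /=; first by rewrite hh'.
by rewrite IH => [|s st]; rewrite !hh'// leqW.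
Qed.

(** Appending a state [b'] to a path multiplies the length of its cell by the
    transition probability to [b']. *)
Lemma walk_markov b t h b' :
  start_law b [set u | (forall s, (s <= t)%N -> walk_state s u = h s) /\
                       walk_state t.+1 u = b']
  = (start_law b [set u | forall s, (s <= t)%N -> walk_state s u = h s]
     * (kernel2 (h t) b')%:E)%E.
Proof.
(* The path [h] up to time [t], followed by [b']. *)
pose h' s := if (s <= t)%N then h s else b'.
have h'E s : (s <= t)%N -> h' s = h s by rewrite /h' => ->.
have h'S : h' t.+1 = b' by rewrite /h' ltnn.
rewrite (_ : [set u | _ /\ _] =
    [set u | forall s, (s <= t.+1)%N -> walk_state s u = h' s]); last first.
  apply/seteqP; split => u /= => [[hs ht] s|hs].
    by rewrite leq_eqVlt ltnS => /predU1P[->|st]; [rewrite h'S|rewrite h'E// hs].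
  by split => [s st|]; rewrite hs ?h'S ?h'E// leqW.
by rewrite !start_law_path -EFinM /= h'S !h'E// (eq_cell h' h)// mulrA.
Qed.

Lemma walk_state_measurable t b : measurable (walk_state t @^-1` [set b]).
Proof.
have [m _ _] := measurable_walk t.
by rewrite -[X in measurable X]setTI; exact: m.
Qed.

Definition two_state_chain : markov_chain R :=
  @MarkovChain R bool kernel2 kernel2_ge0 kernel2_sum1 _ (measurableTypeR R)
    start_law walk_state walk_state_measurable walk_start walk_markov.

End TwoStateChain.

Arguments two_state_chain {R c} c01.

Lemma two_state_irreducible (R : realType) (c : bool -> R)
    (c01 : forall b, 0 <= c b <= 1) : 0 < c false -> c true < 1 ->
  irreducible_chain (two_state_chain c01).
Proof.
move=> cf ct x y.
have [->|xy] := eqVneq x y; first by exists 0%N; rewrite /= eqxx.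
exists 1%N => /=; rewrite (bigD1 y)//= eqxx mulr1 big1 ?addr0; last first.
  by move=> z /negbTE->; rewrite mulr0.
by move: x y xy => [] [] //= _; rewrite /kernel2 ?subr_gt0.
Qed.

(** * Separation of the two maximal hitting times *)

Theorem mainTheorem6 (R : realType) (alpha beta : R)
    (halpha : 0 < alpha) (hab : alpha < beta) (hbeta : beta < 1)
    (hbeta2 : 2^-1 < beta) (M : R) :
  exists (C : markov_chain R) (p : mc_state C -> R),
    [/\ irreducible_chain C,
        stationary_distribution p,
        max_hitting_time p beta = 0%E
      & (M%:E <= max_hitting_time p alpha)%E].
Proof.
pose a := Num.max alpha 2^-1.
have a2 : 2^-1 <= a by rewrite le_max lexx orbT.
have aalpha : alpha <= a by rewrite le_max lexx.
have abeta : a < beta by rewrite gt_max hab.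
pose N := (Num.truncn (2 * M)).+1.
have MN : 2 * M <= N%:R by exact/ltW/truncnS_gt.
have N1 : 1 <= N%:R :> R by rewrite ler1n.
pose q : R := (2 * N%:R)^-1.
have qN : N%:R * q = 2^-1 by rewrite /q; field; lra.
have q0 : 0 < q by rewrite invr_gt0; lra.
have q2 : q <= 2^-1 by nra.
(* Stationarity is the balance [(1 - a) * q = a * (1 - c true)]. *)
pose c b : R := if b then 1 - q * ((1 - a) / a) else q.
have r0 : 0 < (1 - a) / a by rewrite divr_gt0//; lra.
have r1 : (1 - a) / a <= 1 by rewrite ler_pdivrMr; lra.
have c01 b : 0 <= c b <= 1 by rewrite /c; case: b; nra.
pose p (b : bool) : R := if b then a else 1 - a.
have ps : @stationary_distribution R (two_state_chain c01) p.
  split => [[]||y]; rewrite /p ?big_bool /=; [lra|lra|lra|].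
  have ar : a * ((1 - a) / a) = 1 - a by field; lra.
  by case: y; rewrite /kernel2 /c; move: ar; set r := (1 - a) / a; nra.
exists (two_state_chain c01), p; split => //.
- by apply: two_state_irreducible => //=; nra.
- apply: max_hitting_time_eq0 (true : mc_state (two_state_chain c01)) ps _ _.
    by lra.
  by case; rewrite /p; lra.
have pA : alpha <= \sum_(b in [set true]%SET) p b by rewrite big_set1.
apply: le_trans (le_max_hitting_time R (two_state_chain c01) p alpha false _ pA).
apply: le_trans (expected_hitting_time_ge R (two_state_chain c01) false _ N _);
  last by rewrite inE.
rewrite lee_fin /= /kernel2 /c.
(* Bernoulli's inequality *)
have bern n : 1 - n%:R * q <= (1 - q) ^+ n.
  elim: n => [|n IH]; first by rewrite mul0r subr0.
  have : (1 - n%:R * q) * (1 - q) <= (1 - q) ^+ n.+1 by rewrite exprSr ler_pM2r//; lra.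
  have : 0 <= n%:R * q * q by rewrite !mulr_ge0// ltW.
  by rewrite -natr1; nra.
have := bern N; rewrite qN -(natr1 N); move: MN N1 {bern}.
by move: N%:R ((1 - q) ^+ N) => n z MN N1 hz; nra.
Qed.
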